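(* For $w\in\mathbb{F}$, the bounded linear operator \[ X\ni x:=(x_k)_{k\in\mathbb{N}}\mapsto \hat{A}_wx:=w\left(\frac{k}{k+1}x_{k+1}\right)_{k\in\mathbb{N}}\in X \] on the space $(X,\|\cdot\|)$ is chaotic as well as its every power \[ X\ni x:=(x_k)_{k\in\mathbb{N}}\mapsto \hat{A}_w^{\,n}x=w^n\left(\frac{k}{k+n}x_{k+n}\right)_{k\in\mathbb{N}}\in X,\quad n\in\mathbb{N}, \] when $|w|>1$, and is nonhypercyclic (i.e., not hypercyclic) otherwise, when $|w|\le1$. Provided the space $(X,\|\cdot\|)$ is complex (i.e., $\mathbb{F}=\mathbb{C}$), \[ \sigma(\hat{A}_w)=\{\lambda\in\mathbb{C}\mid|\lambda|\le|w|\} \] with \[ \sigma_p(\hat{A}_w)=\{\lambda\in\mathbb{C}\mid|\lambda|<|w|\}\quad\text{and}\quad\sigma_c(\hat{A}_w)=\{\lambda\in\mathbb{C}\mid|\lambda|=|w|\}. \]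
   Context: $\mathbb{F}:=\mathbb{R}$ or $\mathbb{F}:=\mathbb{C}$; $\mathbb{N}=\{1,2,3,\dots\}$, $\mathbb{Z}_+=\{0,1,2,\dots\}$. $X$ is the separable infinite-dimensional Banach space over $\mathbb{F}$ \[ X:=\Big\{(x_k)_{k\in\mathbb{N}}\in\mathbb{F}^{\mathbb{N}}\ \Big|\ \sum_{k=1}^\infty\Big|\frac{x_{k+1}}{k+1}-\frac{x_k}{k}\Big|<\infty\ \text{and}\ \lim_{k\to\infty}\frac{x_k}{k}=0\Big\} \] with the norm $\|x\|:=\sum_{k=1}^\infty\left|\frac{x_{k+1}}{k+1}-\frac{x_k}{k}\right|$. For a (bounded or unbounded) linear operator $A$ in a (real or complex) Banach space $E$ with domain $D(A)$, let $A^0:=I$ (the identity operator) and $C^\infty(A):=\bigcap_{n=0}^\infty D(A^n)$. A nonzero vector $x\in C^\infty(A)$ is hypercyclic for $A$ if its orbit $\{A^nx\}_{n\in\mathbb{Z}_+}$ is dense in $E$; $A$ is hypercyclic if it has a hypercyclic vector. A vector $x\in D(A^N)$ with $A^Nx=x$ for some $N\in\mathbb{N}$ is a periodic point of $A$. $A$ is chaotic if it is hypercyclic and its set of periodic points is dense in $E$. For a closed linear operator $A$ in a complex Banach space $E$, the spectrum $\sigma(A)$ is the disjoint union of the point spectrum $\sigma_p(A)=\{\lambda\in\mathbb{C}\mid A-\lambda I\text{ is not injective}\}$, the continuous spectrum $\sigma_c(A)=\{\lambda\in\mathbb{C}\mid A-\lambda I\text{ is injective, not surjective, and has dense range}\}$,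 and the residual spectrum $\sigma_r(A)=\{\lambda\in\mathbb{C}\mid A-\lambda I\text{ is injective and its range is not dense}\}$.
   Formalization: The formulas for the point spectrum and the continuous spectrum are asserted only for w ≠ 0; for w = 0 the operator is zero, so its point spectrum is {0} and its continuous spectrum is empty, and the printed formulas fail. *)

(* Defs.v *)
From HB Require Import structures.
From mathcomp Require Import all_boot all_order all_algebra.
From mathcomp Require Import complex.
From mathcomp Require Import boolp classical_sets functions reals.
From mathcomp Require Import topology normedtype sequences.

Set Implicit Arguments.
Unset Strict Implicit.
Unset Printing Implicit Defensive.

Import Order.TTheory GRing.Theory Num.Theory.
Import numFieldNormedType.Exports.

Local Open Scope classical_set_scope.
Local Open Scope ring_scope.

Section LinearDynamics.
Variables (K : numFieldType) (E : normedModType K).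
Implicit Types (A : E -> E) (x : E).

(* The operators are everywhere defined, so that [D(A^n)] and [C^oo(A)] are
   the whole space [E]. *)
Definition hypercyclic_vector A x : Prop :=
  x != 0 /\ dense (range (fun n : nat => iter n A x)).

Definition hypercyclic A : Prop := exists x, hypercyclic_vector A x.

Definition periodic_point A x : Prop :=
  exists N : nat, (0 < N)%N /\ iter N A x = x.

Definition chaotic A : Prop :=
  hypercyclic A /\ dense [set x | periodic_point A x].

Definition bounded_operator A : Prop :=
  exists M : K, forall x, `|A x| <= M * `|x|.

Definition shifted A (lambda : K) (x : E) : E := A x - lambda *: x.

Definition point_spectrum A : set K :=
  [set lambda | ~ injective (shifted A lambda)].

Definition continuous_spectrum A : set K :=
  [set lambda | [/\ injective (shifted A lambda),
                    range (shifted A lambda) <> setT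
                  & dense (range (shifted A lambda))]].

Definition residual_spectrum A : set K :=
  [set lambda | injective (shifted A lambda) /\
                ~ dense (range (shifted A lambda))].

Definition spectrum A : set K :=
  point_spectrum A `|` continuous_spectrum A `|` residual_spectrum A.

End LinearDynamics.

(* The field F, which is either the reals or the complex numbers. *)
Variant scalar_kind := RealScalars | ComplexScalars.

Definition scalars (R : realType) (k : scalar_kind) : numFieldType :=
  match k with
  | RealScalars => R : numFieldType
  | ComplexScalars => R[i] : numFieldType
  end.


Section ScalarSeries.
Variable R : realType.

Local Notation C := (R[i] : numFieldType).

Lemma complex_series_dom_cvg (u v : (C : Type)^nat) :
  (forall n, 0 <= u n) -> (forall n, u n <= v n) ->
  cvgn (series v) -> cvgn (series u).
Proof.
move=> u0 uv /cvg_ex[/= l vl].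
have v0 n : 0 <= v n by apply: le_trans (uv n).
have toR (z : R[i]) : 0 <= z -> z = (complex.Re z)%:C%C.
  by case: z => a b; rewrite lecE/= => /andP[/eqP -> _].
have ser (f : nat -> R[i]) n : (forall n, 0 <= f n) ->
    \sum_(0 <= k < n) f k = (\sum_(0 <= k < n) complex.Re (f k))%:C%C.
  by move=> f0; rewrite rmorph_sum/=; apply: eq_bigr => k _; exact: toR.
have Rv : cvgn (series (fun n => complex.Re (v n))).
  apply/cvg_ex; exists (complex.Re l); apply/cvgrPdist_lt => e e0.
  have eC0 : 0 < e%:C%C by rewrite ltcR.
  have := (@cvgrPdist_lt C C _ _ eventually_filter _ _).1 vl _ eC0.
  apply: filterS => n /= vln.
  rewrite -ltcR; apply: le_lt_trans vln.
  apply: le_trans (normc_ge_Re _).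
  by rewrite /series/= ser// raddfB/= lecR.
have /cvg_ex[/= m um] : cvgn (series (fun n => complex.Re (u n))).
  apply: (series_le_cvg _ _ _ Rv) => n.
  - by move: (u0 n); rewrite lecE => /andP[].
  - by move: (v0 n); rewrite lecE => /andP[].
  - by move: (uv n); rewrite lecE => /andP[].
apply: (@cvgP C _ (m%:C%C : C)).
apply: (@cvgrPdist_lt C C _ _ eventually_filter _ _).2 => e e0.
have e1 : 0 < complex.Re e by move: e0; rewrite ltcE => /andP[].
move/cvgrPdist_lt : um => /(_ _ e1); apply: filterS => n /= umn.
rewrite /series/= ser// (toR e (ltW e0)) -rmorphB/=.
by rewrite normc_def/= expr0n addr0 sqrtr_sqr ltcR.
Qed.

Lemma series_dom_cvg (k : scalar_kind) (u v : (scalars R k)^nat) :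
  (forall n, 0 <= u n) -> (forall n, u n <= v n) ->
  cvgn (series v) -> cvgn (series u).
Proof.
case: k u v => u v u0 uv; last exact: complex_series_dom_cvg.
by apply: series_le_cvg => // n; apply: le_trans (uv n).
Qed.

End ScalarSeries.

Lemma num_ler_lim (K : numFieldType) (u v : K^nat) (a b : K) :
  u @ \oo --> a -> v @ \oo --> b -> (\forall n \near \oo, u n <= v n) -> a <= b.
Proof.
move=> ua vb uv; rewrite -subr_ge0.
have vu : (v - u) @ \oo --> b - a by exact: cvgB.
suff -> : b - a = `|b - a| by [].
apply: (cvg_unique (@norm_hausdorff _ K) vu).
apply: cvg_trans (cvg_norm vu); apply: near_eq_cvg.
by apply: filterS uv => n uvn; rewrite ger0_norm// subr_ge0.
Qed.

Section SpaceX.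
Variables (R : realType) (k : scalar_kind).
Local Notation F := (scalars R k).
Implicit Types u : nat -> F.

(* A sequence (x_j), j = 1, 2, 3 and so on, is encoded by [u n := x_(n+1)]:
   [quot u n] is x_j / j, and [Ahat_seq u n] below is w * j / (j+1) * x_(j+1),
   for j = n + 1. *)
Definition quot u : nat -> F := fun n => u n / n.+1%:R.

Definition variation u : nat -> F := fun n => `|quot u n.+1 - quot u n|.

Definition inX u : Prop :=
  cvgn (series (variation u)) /\ quot u @ \oo --> (0 : F).

Definition X_pred : {pred nat -> F} := fun u => `[< inX u >].

Record X := MkX { seq_of :> nat -> F; seq_ofP : seq_of \in X_pred }.

Lemma quotD u v : quot (u + v) = quot u + quot v.
Proof. by apply/funext => n; rewrite /quot fctE mulrDl. Qed.

Lemma quotZ (a : F) u : quot (a *: u) = a *: quot u.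
Proof. by apply/funext => n; rewrite /quot fctE -mulrA. Qed.

Lemma variation_ge0 u n : 0 <= variation u n.
Proof. exact: normr_ge0. Qed.

Lemma variationD u v n : variation (u + v) n <= (variation u + variation v) n.
Proof.
rewrite /variation quotD !fctE opprD addrACA; exact: ler_normD.
Qed.

Lemma variationZ (a : F) u : variation (a *: u) = `|a| *: variation u.
Proof.
by apply/funext => n; rewrite /variation quotZ !fctE -scalerBr normrM.
Qed.

Lemma inX0 : inX 0.
Proof.
have q0 : quot 0 = fun=> 0 by apply/funext => n; rewrite /quot mul0r.
split; rewrite ?q0; last exact: cvg_cst.
apply/cvg_ex; exists 0; rewrite /series/=.
rewrite (_ : (fun _ => _) = fun=> 0); first exact: cvg_cst.
by apply/funext => n; rewrite big1// => i _; rewrite /variation q0 subrr normr0.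
Qed.

Lemma inXD u v : inX u -> inX v -> inX (u + v).
Proof.
move=> [u1 u2] [v1 v2]; split.
  apply: (@series_dom_cvg R k _ (variation u + variation v)).
  - exact: variation_ge0.
  - exact: variationD.
  - exact: is_cvg_seriesD.
by rewrite quotD -[X in _ --> X]addr0; exact: cvgD.
Qed.

Lemma inXZ (a : F) u : inX u -> inX (a *: u).
Proof.
move=> [u1 u2]; split; first by rewrite variationZ; exact: is_cvg_seriesZ.
by rewrite quotZ -[X in _ --> X](mulr0 a); exact: cvgMl_tmp.
Qed.

Fact X_submod_closed : submod_closed X_pred.
Proof.
split=> [|a u v]; first by apply/asboolP; exact: inX0.
move=> /asboolP Xu /asboolP Xv; apply/asboolP; apply: inXD => //.
exact: inXZ.
Qed.

HB.instance Definition _ := [isSub for seq_of].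
HB.instance Definition _ := [Choice of X by <:].
HB.instance Definition _ :=
  GRing.isSubmodClosed.Build F (nat -> F) X_pred X_submod_closed.
HB.instance Definition _ := [SubChoice_isSubLmodule of X by <:].

Lemma X_inX (x : X) : inX x. Proof. exact/asboolP/(seq_ofP x). Qed.

Definition normX (x : X) : F := limn (series (variation x)).

Lemma normX_D (x y : X) : normX (x + y) <= normX x + normX y.
Proof.
have [xy _] := X_inX (x + y); have [cx _] := X_inX x; have [cy _] := X_inX y.
rewrite /normX -lim_seriesD//.
apply: (num_ler_lim xy (is_cvg_seriesD cx cy)).
by apply: nearW => n; apply: ler_sum => i _; exact: variationD.
Qed.

Lemma normX_Z (a : F) (x : X) : normX (a *: x) = `|a| * normX x.
Proof.
have [cx _] := X_inX x.
by rewrite /normX (_ : variation _ = `|a| *: variation x) ?variationZ// lim_seriesZ.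
Qed.

Lemma normX_eq0 (x : X) : normX x = 0 -> x = 0.
Proof.
have [cx qx] := X_inX x => x0.
have v0 n : variation x n = 0.
  apply/le_anti; rewrite variation_ge0 andbT -x0.
  apply: (@num_ler_lim F (fun=> variation x n)); [exact: cvg_cst|exact: cx|].
  exists n.+1 => // m /= nm; rewrite /series/= (big_cat_nat _ (n := n.+1))//=.
  rewrite big_nat_recr//= addrAC ler_wpDl// addr_ge0// sumr_ge0// => i _;
    exact: variation_ge0.
have qc n : quot x n = quot x 0.
  elim: n => // n <-; apply/eqP; rewrite -subr_eq0 -normr_eq0.
  by rewrite -/(variation x n) v0.
have q0 : quot x 0 = 0.
  apply: (cvg_unique (@norm_hausdorff _ F) _ qx).
  rewrite (_ : quot x = fun=> quot x 0); first exact: cvg_cst.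
  by apply/funext.
apply/val_inj/funext => n /=; have /eqP := qc n.
by rewrite q0 mulf_eq0 invr_eq0 pnatr_eq0 orbF => /eqP.
Qed.

HB.instance Definition _ :=
  Lmodule_isNormed.Build F X normX_D normX_Z normX_eq0.

Lemma X_normE (x : X) : `|x| = limn (series (variation x)).
Proof. by []. Qed.

Section Shift.
Variable w : F.

Definition Ahat_seq u : nat -> F :=
  fun n => w * (n.+1%:R / n.+2%:R * u n.+1).

Lemma quot_Ahat u n : quot (Ahat_seq u) n = w * quot u n.+1.
Proof.
rewrite /quot /Ahat_seq -mulrA; congr (_ * _).
by rewrite mulrC !mulrA mulVf ?pnatr_eq0// mul1r mulrC.
Qed.

Lemma inX_Ahat u : inX u -> inX (Ahat_seq u).
Proof.
move=> [u1 u2].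
have qE : quot (Ahat_seq u) = w *: [sequence quot u n.+1]_n.
  by apply/funext => n; rewrite quot_Ahat.
split; last first.
  by rewrite qE -[X in _ --> X](mulr0 w); apply: cvgMl_tmp; rewrite cvg_shiftS.
have vE : variation (Ahat_seq u) = `|w| *: [sequence variation u n.+1]_n.
  by apply/funext => n; rewrite /variation qE !fctE -scalerBr normrM.
rewrite vE; apply: is_cvg_seriesZ.
rewrite (_ : series _ =
  (fun n => series (variation u) n.+1) - cst (variation u 0%N)); last first.
  apply/funext => n; rewrite !fctE /series/= big_nat_recl//.
  by rewrite addrAC subrr add0r.
apply: is_cvgB; last exact: is_cvg_cst.
by apply/cvg_ex; exists (limn (series (variation u))); rewrite cvg_shiftS.
Qed.

Lemma Ahat_subproof (x : X) : Ahat_seq x \in X_pred.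
Proof. by apply/asboolP; apply: inX_Ahat; exact: X_inX. Qed.

Definition Ahat (x : X) : X := MkX (Ahat_subproof x).

End Shift.

End SpaceX.

(* Main.v *)
(* The quotients q_n = x_n / n identify X with the null sequences of bounded
   variation and Ahat w with w times the left shift, an operator of norm |w|
   with a right inverse S of norm 1 / |w|, both for w <> 0.  Finitely supported
   q are dense and killed by powers of the shift.  For |w| > 1 the powers of S
   contract, so a series S^(N_j) z_j, with z_j running infinitely often through
   a countable dense set of finitely supported vectors and N_j growing fast, is
   hypercyclic, and the sums of S^(m j) y over j are periodic and dense.  For
   |w| <= 1 orbits are bounded.  Eigenvectors are geometric sequences, the
   resolvent for |lambda| > |w| is a Neumann series, and on |lambda| = |w| the
   Neumann series terminates on finitely supported vectors. *)
Require Import Defs.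
From HB Require Import structures.
From mathcomp Require Import all_boot all_order all_algebra.
From mathcomp Require Import complex.
From mathcomp Require Import boolp classical_sets functions reals.
From mathcomp Require Import topology normedtype sequences.

Set Implicit Arguments.
Unset Strict Implicit.
Unset Printing Implicit Defensive.

Import Order.TTheory GRing.Theory Num.Theory.
Import numFieldNormedType.Exports.

Local Open Scope classical_set_scope.
Local Open Scope ring_scope.

(** * Convergence, separability and geometric bounds over both kinds of scalars *)

Lemma series_norm_bounded_cvg (R : realType) (u : nat -> R) (M : R) :
  (forall n, \sum_(0 <= j < n) `|u j| <= M) -> cvgn (series u).
Proof.
move=> uM; apply: normed_cvg; apply: nondecreasing_is_cvgn.
  by apply: nondecreasing_series => n _ _; exact: normr_ge0.
by exists M => _ [n _ <-]; exact: uM.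
Qed.

Lemma complex_norm_lt (R : realType) (z e : R[i]) : 0 < e ->
  `|complex.Re z| < complex.Re e / 2 -> `|complex.Im z| < complex.Re e / 2 ->
  `|z| < e.
Proof.
case: e => e b; rewrite ltcE/= => /andP[/eqP -> e0] xe ye.
rewrite [z]complexE; apply: le_lt_trans (ler_normD _ _) _.
rewrite normrM complexiE normCi mul1r !normc_def/= !expr0n/= !addr0 !sqrtr_sqr.
by rewrite -rmorphD/= ltcR [ltRHS]splitr ltrD.
Qed.

Lemma complex_series_norm_bounded_cvg (R : realType)
    (u : nat -> (R[i] : numFieldType)) (M : R[i]) :
  (forall n, \sum_(0 <= j < n) `|u j| <= M) -> cvgn (series u).
Proof.
move=> uM.
have bd n : \sum_(0 <= j < n) complex.Re `|u j| <= complex.Re M.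
  by have := uM n; rewrite lecE !raddf_sum => /andP[].
have /cvg_ex[/= a ha] : cvgn (series (fun n => complex.Re (u n))).
  apply: (@series_norm_bounded_cvg _ _ (complex.Re M)) => n.
  apply: le_trans (bd n); apply: ler_sum => j _.
  by have := normc_ge_Re (u j); rewrite lecE => /andP[].
have /cvg_ex[/= b hb] : cvgn (series (fun n => complex.Im (u n))).
  apply: (@series_norm_bounded_cvg _ _ (complex.Re M)) => n.
  apply: le_trans (bd n); apply: ler_sum => j _.
  (* Multiplying by i turns the imaginary part into a real part up to sign and keeps the modulus. *)
  have := normc_ge_Re (u j * 'i%C); rewrite normrM complexiE normCi mulr1 -complexiE.
  by rewrite ReiNIm normrN lecE => /andP[].
apply: (@cvgP (R[i] : numFieldType) _ ((a +i* b)%C : (R[i] : numFieldType))).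
apply: (@cvgrPdist_lt (R[i] : numFieldType) (R[i] : numFieldType)
  _ _ eventually_filter _ _).2 => e e0.
have e1 : 0 < complex.Re e / 2.
  by move: e0; rewrite ltcE => /andP[_ ?]; rewrite divr_gt0.
move/cvgrPdist_lt : ha => /(_ _ e1); move/cvgrPdist_lt : hb => /(_ _ e1).
apply: filterS2 => n /= yb xa; apply: complex_norm_lt => //.
- by move: xa; rewrite /series/= -raddf_sum raddfB.
- by move: yb; rewrite /series/= -raddf_sum raddfB.
Qed.

(** Completeness of the scalars enters the later constructions in this form, which avoids separating
    the real and the complex case again. *)
Lemma scalars_series_cvg (R : realType) (k : scalar_kind)
    (u : nat -> scalars R k) (M : scalars R k) :
  (forall n, \sum_(0 <= j < n) `|u j| <= M) -> cvgn (series u).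
Proof.
case: k u M => u M uM; first exact: (series_norm_bounded_cvg uM).
exact: (complex_series_norm_bounded_cvg uM).
Qed.

Lemma scalars_archi (R : realType) (k : scalar_kind) (x : scalars R k) :
  0 <= x -> exists n : nat, x < n%:R.
Proof.
case: k x => x x0.
  by exists (Num.bound x); apply: archi_boundP.
have xE : x = (complex.Re x)%:C%C.
  by move: (x0); rewrite lecE; case: (x) => p q /= /andP[/eqP -> _].
exists (Num.bound (complex.Re x)).
rewrite xE -(rmorph_nat (real_complex R)) ltcR; apply: archi_boundP.
by move: x0; rewrite lecE => /andP[].
Qed.

Lemma rat_approx (R : realType) (x e : R) : 0 < e ->
  exists q : rat, `|x - ratr q| < e.
Proof.
move=> e0; have [|q] := @rat_in_itvoo R (x - e) (x + e).
  by rewrite ltrD2l gtrN.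
by rewrite in_itv/= -ltr_distl distrC => xq; exists q.
Qed.

(** Pairs of rationals serve both fields at once, so that finite lists of coefficients can later be
    indexed by the countable type [seq (rat * rat)]. *)
Lemma scalars_separable (R : realType) (k : scalar_kind) :
  exists f : rat * rat -> scalars R k,
    forall x e, 0 < e -> exists q, `|x - f q| < e.
Proof.
case: k.
  exists (fun q => ratr q.1) => x e e0.
  by have [q xq] := rat_approx x e0; exists (q, 0).
exists (fun q => (ratr q.1 +i* ratr q.2)%C) => x e e0.
have e1 : 0 < complex.Re e / 2.
  by move: e0; rewrite ltcE => /andP[_ ?]; rewrite divr_gt0.
have [a xa] := rat_approx (complex.Re x) e1.
have [b xb] := rat_approx (complex.Im x) e1.
by exists (a, b); apply: complex_norm_lt => //; case: (x) xa xb.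
Qed.

Lemma dense_normP (K : numFieldType) (E : normedModType K) (S : set E) :
  dense S <-> forall x e, 0 < e -> exists2 y, S y & `|x - y| < e.
Proof.
split=> [dS x e e0|SP U [x Ux] oU].
  have [|y [xy Sy]] := dS (ball x e) _ (ball_open x e).
    by exists x; exact: ballxx.
  by exists y => //; move: xy; rewrite -ball_normE.
have /nbhs_ballP[e /= e0 xeU] : nbhs x U by exact: open_nbhs_nbhs.
have [y Sy xy] := SP x e e0; exists y; split=> //.
by apply: xeU; rewrite -ball_normE.
Qed.

Lemma geometric_block_le (K : numFieldType) (r : K) (m n : nat) :
  0 <= r < 1 -> \sum_(m <= j < n) r ^+ j <= r ^+ m / (1 - r).
Proof.
move=> /andP[r0 r1]; have r1' : 0 < 1 - r by rewrite subr_gt0.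
rewrite ler_pdivlMr//; case: (leqP m n) => mn; last first.
  by rewrite big_geq ?mul0r ?exprn_ge0// ltnW.
rewrite -(subnKC mn); elim: (n - m)%N => [|p ih].
  by rewrite addn0 big_geq// mul0r exprn_ge0.
rewrite addnS big_nat_recr ?leq_addr//=.
suff -> : (\sum_(m <= j < m + p) r ^+ j + r ^+ (m + p)) * (1 - r) =
  r ^+ m - r ^+ (m + p).+1 by rewrite gerBl exprn_ge0.
elim: p {ih} => [|p ih].
  by rewrite addn0 big_geq// add0r exprS mulrBr mulr1 mulrC.
rewrite addnS big_nat_recr ?leq_addr//= mulrDl ih mulrBr mulr1 -exprSr.
by rewrite addrA subrK.
Qed.

Lemma scalars_expr_small (R : realType) (k : scalar_kind) (C r e : scalars R k) :
  0 <= C -> 0 <= r < 1 -> 0 < e -> exists N, forall n, (N <= n)%N -> C * r ^+ n < e.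
Proof.
move=> C0 r01 e0; have r0 : 0 <= r by case/andP: r01.
(* Dividing by [C + 1] rather than [C] covers [C = 0]. *)
have C1 : 0 < C + 1 by rewrite ltr_wpDl.
have : cvgn (series (fun n => r ^+ n)).
  apply: (@scalars_series_cvg _ _ _ (r ^+ 0 / (1 - r))) => n.
  apply: le_trans (geometric_block_le 0 n r01).
  by apply: ler_sum => j _; rewrite ger0_norm// exprn_ge0.
move/cvg_series_cvg_0 => /cvgrPdist_lt/(_ (e / (C + 1))).
rewrite divr_gt0// => /(_ isT)[N _ NP]; exists N => n Nn.
have := NP n Nn; rewrite /= sub0r normrN ger0_norm ?exprn_ge0// ltr_pdivlMr//.
apply: le_lt_trans; rewrite mulrC ler_wpM2l ?exprn_ge0//.
by rewrite lerDl.
Qed.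

(** Applied to the norm of a difference, this turns estimates along partial sums into exact
    equalities. *)
Lemma le0_geometric (R : realType) (k : scalar_kind) (a C r : scalars R k) :
  0 <= C -> 0 <= r < 1 -> (forall n, a <= C * r ^+ n) -> a <= 0.
Proof.
move=> C0 r01 aC.
(* The order on complex numbers is partial; comparability with a real number makes [a] real, which
   allows a proof by contradiction. *)
have aR : a \is Num.real.
  by rewrite (ler_real (aC 0%N)) ger0_real// expr0 mulr1.
rewrite real_leNgt ?real0//; apply/negP => a0.
have [N /(_ N (leqnn N))] := scalars_expr_small C0 r01 a0.
by move=> /lt_le_trans/(_ (aC N)); rewrite ltxx.
Qed.

(** * The space [X] through its quotients, and its completeness *)

Section SpaceXTheory.
Variables (R : realType) (k : scalar_kind).
Local Notation F := (scalars R k).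
Local Notation X := (X R k).
Implicit Types (x y : X) (q : nat -> F).

Lemma quotXD x y n : quot (x + y) n = quot x n + quot y n.
Proof. by rewrite -[RHS]/((quot x + quot y) n) -quotD. Qed.

Lemma quotXZ (a : F) x n : quot (a *: x) n = a * quot x n.
Proof. by rewrite -[RHS]/((a *: quot x) n) -quotZ. Qed.

Lemma quotX0 n : quot (0 : X) n = 0.
Proof. by rewrite -(scale0r (0 : X)) quotXZ mul0r. Qed.

Lemma quotXB x y n : quot (x - y) n = quot x n - quot y n.
Proof. by rewrite quotXD -scaleN1r quotXZ mulN1r. Qed.

Lemma quotX_sum m n (u : nat -> X) j :
  quot (\sum_(m <= i < n) u i) j = \sum_(m <= i < n) quot (u i) j.
Proof.
elim/big_rec2: _ => [|i y1 y2 _ ih]; first exact: quotX0.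
by rewrite quotXD ih.
Qed.

Lemma quotX_inj x y : (forall n, quot x n = quot y n) -> x = y.
Proof.
move=> xy; apply/val_inj/funext => n /=; have := xy n.
by move=> /(mulIf _) -> //; rewrite invr_eq0 pnatr_eq0.
Qed.

Lemma sum_variation_le_norm x n : \sum_(0 <= j < n) variation x j <= `|x|.
Proof.
have [cx _] := X_inX x; rewrite X_normE.
apply: (@num_ler_lim F (fun=> _)); [exact: cvg_cst|exact: cx|].
exists n => // m /= nm; rewrite /series/= [leRHS](big_cat_nat _ (n := n))//=.
by rewrite lerDl sumr_ge0// => i _; exact: variation_ge0.
Qed.

Lemma norm_le_sum_variation x (C : F) :
  (forall n, \sum_(0 <= j < n) variation x j <= C) -> `|x| <= C.
Proof.
have [cx _] := X_inX x => xC; rewrite X_normE.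
apply: (@num_ler_lim F _ (fun=> C) _ _ cx); first exact: cvg_cst.
exact: nearW.
Qed.

(** As the quotients tend to 0, [quot x n] is the limit in [m] of [quot x n - quot x m], which
    telescopes into terms of the variation. *)
Lemma quot_le_norm x n : `|quot x n| <= `|x|.
Proof.
have [_ qx] := X_inX x.
apply: (@num_ler_lim F (fun m => `|quot x n - quot x m|) (fun=> `|x|)).
- rewrite -[X in `|X|]subr0; apply: cvg_norm.
  by apply: cvgB => //; exact: cvg_cst.
- exact: cvg_cst.
- exists n => // m /= nm; rewrite distrC -telescope_sumr//.
  apply: le_trans (ler_norm_sum _ _ _) _.
  apply: le_trans (sum_variation_le_norm x m).
  rewrite [leRHS](big_cat_nat _ (n := n))//= lerDr sumr_ge0// => i _.
  exact: variation_ge0.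
Qed.

(** Converse of the passage to quotients: a null sequence of bounded variation, multiplied by
    [n.+1], gives the coordinates of a vector. Vectors are built below by prescribing their
    quotients. *)
Lemma quotX_surj q (M : F) :
  (forall n, \sum_(0 <= j < n) `|q j.+1 - q j| <= M) -> q @ \oo --> (0 : F) ->
  exists x : X, `|x| <= M /\ forall n, quot x n = q n.
Proof.
move=> qM q0; pose u : nat -> F := fun n => q n * n.+1%:R.
have uq : quot u = q.
  by apply/funext => n; rewrite /quot mulfK ?pnatr_eq0.
have Xu : u \in @X_pred R k.
  apply/asboolP; split; rewrite ?uq//.
  apply: (@scalars_series_cvg _ _ _ M) => n; apply: le_trans (qM n).
  by apply: ler_sum => j _; rewrite /variation normr_id uq.
exists (MkX Xu); split=> [|n]; last by rewrite -[LHS]/(quot u n) uq.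
apply: norm_le_sum_variation => n; apply: le_trans (qM n).
by apply: ler_sum => j _; rewrite -[leLHS]/(variation u j) /variation uq.
Qed.

(** Completeness of [X] in quantitative form. The sum is built one quotient at a time, and the
    bounds on partial sums survive the limit. *)
Lemma X_geometric_series (u : nat -> X) (M r : F) : 0 <= r < 1 ->
  (forall j, `|u j| <= M * r ^+ j) ->
  exists x, forall n, `|x - \sum_(0 <= j < n) u j| <= M / (1 - r) * r ^+ n.
Proof.
move=> r01 uM; pose s n := \sum_(0 <= j < n) u j.
pose C n := M / (1 - r) * r ^+ n.
have r0 : 0 <= r by case/andP: r01.
have M0 : 0 <= M by have := le_trans (normr_ge0 _) (uM 0%N); rewrite mulr1.
have blk n p : \sum_(n <= j < p) M * r ^+ j <= C n.
  rewrite -mulr_sumr /C -mulrA [_^-1 * _]mulrC ler_wpM2l//.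
  exact: geometric_block_le.
have sC n p : (n <= p)%N -> `|s p - s n| <= C n.
  move=> np; rewrite /s [X in X - _](big_cat_nat _ (n := n))//= addrAC subrr add0r.
  apply: le_trans (ler_norm_sum _ _ _) _; apply: le_trans (blk n p).
  exact: ler_sum.
have /choice[Q QP] : forall m, exists l : F, (fun n => quot (s n) m) @ \oo --> l.
  move=> m; apply/cvg_ex.
  rewrite (_ : (fun _ => _) = series (fun j => quot (u j) m)); last first.
    by apply/funext => n; rewrite quotX_sum.
  apply: (@scalars_series_cvg _ _ _ (C 0%N)) => n.
  apply: le_trans (blk 0%N n); apply: ler_sum => j _.
  exact: le_trans (quot_le_norm _ _) (uM j).
have QC n m : `|Q m - quot (s n) m| <= C n.
  apply: (@num_ler_lim F (fun p => `|quot (s p) m - quot (s n) m|) (fun=> C n)).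
  - by apply: cvg_norm; apply: cvgB => //; exact: cvg_cst.
  - exact: cvg_cst.
  - exists n => // p /= np; rewrite -quotXB.
    exact: le_trans (quot_le_norm _ _) (sC _ _ np).
(* Only finitely many terms of the variation are involved, so the limit in [p] may be taken before
   [Q] is known to come from a vector of [X]. *)
have QV n N : \sum_(0 <= m < N)
    `|(Q m.+1 - quot (s n) m.+1) - (Q m - quot (s n) m)| <= C n.
  apply: (@num_ler_lim F (fun p => \sum_(0 <= m < N)
    `|(quot (s p) m.+1 - quot (s n) m.+1) - (quot (s p) m - quot (s n) m)|)
    (fun=> C n)).
  - apply: (cvg_big (@add_continuous F)) => m _; apply: cvg_norm.
    by apply: cvgB; apply: cvgB => //; exact: cvg_cst.
  - exact: cvg_cst.
  - exists n => // p /= np; apply: le_trans (sC _ _ np).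
    apply: le_trans (sum_variation_le_norm _ N); apply: ler_sum => m _.
    by rewrite /variation !quotXB.
(* [Q] is a uniform limit of the null sequences [quot (s n)]. *)
have Q0 : Q @ \oo --> (0 : F).
  apply/cvgrPdist_lt => e e0; have e2 : 0 < e / 2 by rewrite divr_gt0.
  have M1 : 0 <= M / (1 - r).
    by case/andP: r01 => _ r1; rewrite divr_ge0// subr_ge0 ltW.
  have [n /(_ n (leqnn n)) nC] := scalars_expr_small M1 r01 e2.
  have [_ /cvgrPdist_lt/(_ _ e2)] := X_inX (s n).
  apply: filterS => m; rewrite !sub0r !normrN => sm.
  rewrite -(subrK (quot (s n) m) (Q m)) [e]splitr.
  apply: le_lt_trans (ler_normD _ _) _; apply: ltrD sm.
  exact: le_lt_trans (QC n m) nC.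
have [|x [_ xQ]] := @quotX_surj Q (C 0%N) _ Q0.
  move=> N; apply: le_trans (QV 0%N N); apply: ler_sum => m _.
  by rewrite /s big_geq// !quotX0 !subr0.
exists x => n; apply: norm_le_sum_variation => N; apply: le_trans (QV n N).
by apply: ler_sum => m _; rewrite /variation !quotXB !xQ.
Qed.

End SpaceXTheory.

(** * Iterates of linear maps and of right inverses *)

Lemma linear_iter (K : pzRingType) (V : lmodType K) (f : V -> V) n :
  linear f -> linear (iter n f).
Proof. by move=> lf; elim: n => // n ih a u v; rewrite /= ih lf. Qed.

(** Operators are plain functions here; this gives temporary access to the lemmas on bundled linear
    maps. *)
Lemma linear_mapE (K : pzRingType) (U V : lmodType K) (f : U -> V) :
  linear f -> exists g : {linear U -> V}, f = g :> (U -> V).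
Proof.
move=> lf.
pose g : {linear U -> V} := HB.pack f (GRing.isLinear.Build _ _ _ _ f lf).
by exists g.
Qed.

Lemma iter_norm_le (K : numFieldType) (V : normedModType K) (f : V -> V)
    (c : K) n x : 0 <= c -> (forall x, `|f x| <= c * `|x|) ->
  `|iter n f x| <= c ^+ n * `|x|.
Proof.
move=> c0 fc; elim: n => [|n ih]; first by rewrite mul1r.
by apply: le_trans (fc _) _; rewrite exprS -mulrA ler_wpM2l.
Qed.

Lemma iter_cancel_le (T : Type) (B S : T -> T) a b x : cancel S B ->
  (a <= b)%N -> iter a B (iter b S x) = iter (b - a) S x.
Proof.
move=> SK; elim: a b => [|a ih] [|b]// ab.
by rewrite iterSr /= SK ih.
Qed.

Lemma iter_cancel_ge (T : Type) (B S : T -> T) a b x : cancel S B ->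
  (b <= a)%N -> iter a B (iter b S x) = iter (a - b) B x.
Proof.
by move=> SK ba; rewrite -{1}(subnK ba) iterD (iter_cancel_le _ SK)// subnn.
Qed.

Lemma iter_linear0 (K : pzRingType) (V : lmodType K) (f : V -> V) m n x :
  linear f -> iter m f x = 0 -> (m <= n)%N -> iter n f x = 0.
Proof.
move=> lf x0 mn; rewrite -(subnK mn) iterD x0.
by have [g ->] := linear_mapE (linear_iter (n - m) lf); rewrite linear0.
Qed.

(** * Chaos from a contracting right inverse and a dense set of nilpotent vectors *)

Section HypercyclicityCriterion.
Variables (R : realType) (k : scalar_kind).
Local Notation F := (scalars R k).
Local Notation X := (X R k).
Variables (B S : X -> X) (L c : F).
Hypotheses (linB : linear B) (L_ge0 : 0 <= L).
Hypothesis B_le : forall x, `|B x| <= L * `|x|.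
Hypothesis c01 : 0 <= c < 1.
Hypothesis S_le : forall x, `|S x| <= c * `|x|.
Hypothesis SK : cancel S B.

Let c_ge0 : 0 <= c. Proof. by case/andP: c01. Qed.

(** Decoding an index as a pair [(t, n)] makes [y t] occur once for each [n], hence infinitely
    often; indices that code no pair give 0. *)
Lemma recurrent_enumeration (T : countType) (y : T -> X) :
  (forall t, exists m, iter m B (y t) = 0) ->
  exists z : nat -> X, (forall i, exists m, iter m B (z i) = 0) /\
    forall t N, exists2 i, (N <= i)%N & z i = y t.
Proof.
move=> ynil.
exists (fun i => if @unpickle (T * nat)%type i is Some p then y p.1 else 0).
split=> [i|t N].
  by case: unpickle => [p|]; [exact: ynil|exists 0%N].
suff [n Nn] : exists n : nat, (N <= pickle (t, n))%N.
  by exists (pickle (t, n)) => //; rewrite pickleK.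
apply/not_existsP => Nlt.
have ltN (n : nat) : (pickle (t, n) < N)%N by rewrite ltnNge; apply/negP/Nlt.
(* Pigeonhole: otherwise [N.+1] distinct codes would lie below [N]. *)
pose f (n : 'I_N.+1) := Ordinal (ltN n).
have /leq_card : injective f.
  move=> n p [] /(congr1 (@unpickle (T * nat)%type)).
  by rewrite !pickleK => -[] /val_inj.
by rewrite !card_ord ltnn.
Qed.

(* The hypercyclic vector is the sum of S^(N_j) z_j, with gaps between the N_j
   so large that B^(N_i) kills the terms j < i and maps the terms j > i to
   vectors of norm at most 2^-j. *)
Lemma hypercyclic_of_nilpotent_dense (T : countType) (y : T -> X) :
  (forall t, exists m, iter m B (y t) = 0) -> dense (range y) ->
  (exists v : X, v != 0) -> hypercyclic B.
Proof.
move=> /recurrent_enumeration[z [/choice[m mz] zy]] /dense_normP dy [v v0].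
pose h : F := 2^-1; have h0 : 0 < h by rewrite invr_gt0.
have h01 : 0 <= h < 1 by rewrite ltW//= invf_lt1// ltr1n.
have /choice[g gz] : forall j, exists g, forall n, (g <= n)%N ->
    `|z j| * c ^+ n < h ^+ j.
  by move=> j; apply: scalars_expr_small => //; rewrite exprn_gt0.
(* For [i < j] the gap between [pos i] and [pos j] is at least [m i + g j]: [m i] lets [B] kill
   [z i], and [g j] makes the iterate of [S] on [z j] small. *)
pose pos j := (\sum_(i < j) m i + \sum_(i < j.+1) g i)%N.
have posS j : pos j.+1 = (pos j + m j + g j.+1)%N.
  rewrite /pos (big_ord_recr j) (big_ord_recr j.+1)/= addnA.
  by congr (_ + _)%N; exact: addnAC.
have pos_lt i j : (i < j)%N -> (pos i + m i + g j <= pos j)%N.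
  elim: j => // j ih; rewrite ltnS leq_eqVlt => /predU1P[->|/ih ij].
    by rewrite posS.
  rewrite posS leq_add2r (leq_trans _ (leq_addr _ _))//.
  exact: leq_trans (leq_addr _ _) ij.
have g_pos j : (g j <= pos j)%N.
  by rewrite /pos big_ord_recr/= addnA leq_addl.
have Sz j n : (g j <= n)%N -> `|iter n S (z j)| <= h ^+ j.
  move=> gn; apply: le_trans (iter_norm_le _ _ c_ge0 S_le) _.
  by rewrite mulrC ltW// gz.
pose u j := iter (pos j) S (z j).
have uh j : `|u j| <= 1 * h ^+ j by rewrite mul1r; exact: Sz.
have [x xu] := X_geometric_series h01 uh.
pose D := h / (1 - h) + 1.
have h1 : 0 < 1 - h by rewrite subr_gt0; case/andP: h01.
have D0 : 0 <= D by rewrite addr_ge0// divr_ge0 ?ltW.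
(* In [D], the part [h / (1 - h)] bounds the terms after [i], and the summand 1 pays for truncating
   the series at [p], chosen so large that the tail stays below [h ^+ i] even after [B] has been
   applied [pos i] times. *)
have orb i : `|z i - iter (pos i) B x| <= D * h ^+ i.
  have linBi := linear_iter (pos i) linB.
  have Li0 : 0 <= L ^+ pos i * (1 / (1 - h)).
    by rewrite mulr_ge0 ?exprn_ge0// divr_ge0// ltW.
  have [N NP] := scalars_expr_small Li0 h01 (exprn_gt0 i h0).
  pose p := maxn N i.+1.
  have ip : (i.+1 <= p)%N by rewrite leq_maxr.
  have Bs : iter (pos i) B (\sum_(0 <= j < p) u j) =
      z i + \sum_(i.+1 <= j < p) iter (pos j - pos i) S (z j).
    have [f fE] := linear_mapE linBi; rewrite fE linear_sum.
    rewrite (big_cat_nat _ (n := i.+1))//= big_nat_recr//= big_nat big1 ?add0r.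
      congr (_ + _); first by rewrite -fE iter_cancel_le// subnn.
      apply: eq_big_nat => j /andP[ij _]; rewrite -fE iter_cancel_le//.
      have := pos_lt _ _ ij; rewrite -addnA; exact/leq_trans/leq_addr.
    move=> j /andP[_ /pos_lt ji]; rewrite -fE iter_cancel_ge//; last first.
      by move: ji; rewrite -addnA; exact/leq_trans/leq_addr.
    apply: iter_linear0 (mz j) _ => //.
    rewrite leq_subRL; first exact: leq_trans (leq_addr _ _) ji.
    by move: ji; rewrite -addnA; exact/leq_trans/leq_addr.
  have -> : z i - iter (pos i) B x =
      - \sum_(i.+1 <= j < p) iter (pos j - pos i) S (z j)
      - iter (pos i) B (x - \sum_(0 <= j < p) u j).
    have [f fE] := linear_mapE linBi; rewrite [in RHS]fE linearB -fE Bs.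
    by rewrite opprB addrA [- _ + _]addrC addrK.
  apply: le_trans (ler_normB _ _) _; rewrite normrN mulrDl mul1r lerD//.
    apply: le_trans (ler_norm_sum _ _ _) _.
    rewrite mulrAC -exprS.
    apply: le_trans (geometric_block_le _ _ h01).
    rewrite big_nat [leRHS]big_nat; apply: ler_sum => j /andP[ij _].
    apply: Sz; rewrite leq_subRL.
      by apply: leq_trans (pos_lt _ _ ij); rewrite leq_add2r leq_addr.
    have := pos_lt _ _ ij; rewrite -addnA; exact/leq_trans/leq_addr.
  apply: le_trans (iter_norm_le _ _ L_ge0 B_le) _.
  apply: (@le_trans _ _ (L ^+ pos i * (1 / (1 - h)) * h ^+ p)).
    by rewrite -mulrA ler_wpM2l ?exprn_ge0.
  by apply/ltW/NP; rewrite leq_maxl.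
(* Each [y t] recurs as some [z i] with [i] as large as desired, so the error [D * h ^+ i] can be
   made small. *)
have dorb v' e : 0 < e -> exists2 y,
    range (fun n => iter n B x) y & `|v' - y| < e.
  move=> e0; have e2 : 0 < e / 2 by rewrite divr_gt0.
  have [_ [t _ <-] vt] := dy v' _ e2.
  have [N NP] := scalars_expr_small D0 h01 e2.
  have [i Ni zi] := zy t N; exists (iter (pos i) B x); first by exists (pos i).
  rewrite -(subrK (z i) v') -addrA [e]splitr.
  apply: le_lt_trans (ler_normD _ _) _; rewrite zi ltrD// -zi.
  exact: le_lt_trans (orb i) (NP _ Ni).
exists x; split; last exact/dense_normP.
(* The orbit of 0 is constant, so it cannot come closer to [v] than the norm of [v]. *)
apply/eqP => x0; have [_ [n _ <-]] : exists2 y,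
    range (fun n => iter n B x) y & `|v - y| < `|v|.
  by apply: dorb; rewrite normr_gt0.
by rewrite x0 (@iter_linear0 _ _ _ 0 n)// subr0 ltxx.
Qed.

(* If B^m y = 0 then the sum of S^(m j) y over j is periodic, and it is close
   to y when m is large. *)
Lemma dense_periodic_of_nilpotent_dense :
  dense [set y | exists m, iter m B y = 0] -> dense [set x | periodic_point B x].
Proof.
move=> /dense_normP dn; apply/dense_normP => v e e0.
have e2 : 0 < e / 2 by rewrite divr_gt0.
have [y [m0 ym0] vy] := dn v _ e2.
have c1 : 0 < 1 - c by rewrite subr_gt0; case/andP: c01.
(* With [r = c ^+ m] the final error is [|y| / (1 - r) * r]. Its constant depends on [m], so [N] is
   chosen with the larger constant [|y| / (1 - c)]. *)
have C0 : 0 <= `|y| / (1 - c) by rewrite divr_ge0// ltW.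
have [N NP] := scalars_expr_small C0 c01 e2.
pose m := (maxn (maxn m0 N) 1); have m_gt0 : (0 < m)%N by rewrite leq_maxr.
have Nm : (N <= m)%N by rewrite /m -maxnA (leq_trans (leq_maxl _ 1))// leq_maxr.
have ym : iter m B y = 0.
  by apply: iter_linear0 ym0 _ => //; rewrite /m -maxnA leq_maxl.
have [r rE] : exists r, r = c ^+ m by exists (c ^+ m).
have rc : r <= c.
  by rewrite rE -(prednK m_gt0) exprS ler_piMr// exprn_ile1// ltW; case/andP: c01.
have r01 : 0 <= r < 1.
  by rewrite {1}rE exprn_ge0//=; apply: le_lt_trans rc _; case/andP: c01.
pose u j := iter (m * j) S y.
have ur j : `|u j| <= `|y| * r ^+ j.
  by rewrite mulrC rE -exprM; exact: iter_norm_le.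
have [x xu] := X_geometric_series r01 ur.
have [r0 rlt1] := andP r01; have r1 : 0 < 1 - r by rewrite subr_gt0.
pose D := `|y| / (1 - r); have D0 : 0 <= D by rewrite divr_ge0// ltW.
have linBm := linear_iter m linB.
(* Applying [B] [m] times kills the first term and moves every other term to the place before it. *)
have Bs p : iter m B (\sum_(0 <= j < p.+1) u j) = \sum_(0 <= j < p) u j.
  have [f fE] := linear_mapE linBm; rewrite fE linear_sum big_nat_recl//=.
  rewrite -fE /u muln0/= ym add0r; apply: eq_bigr => j _.
  by rewrite iter_cancel_le ?leq_pmulr// mulnS addKn.
have Bx : iter m B x = x.
  apply/eqP; rewrite -subr_eq0 -normr_le0.
  apply: (@le0_geometric _ _ _ (L ^+ m * D + D) r) => // [|p].
    by rewrite addr_ge0// mulr_ge0// exprn_ge0.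
  have -> : iter m B x - x = iter m B (x - \sum_(0 <= j < p.+1) u j) -
      (x - \sum_(0 <= j < p) u j).
    have [f fE] := linear_mapE linBm; rewrite [in RHS]fE linearB -fE Bs.
    by rewrite opprB addrA subrK.
  apply: le_trans (ler_normB _ _) _; rewrite mulrDl lerD//.
  apply: le_trans (iter_norm_le _ _ L_ge0 B_le) _.
  rewrite -mulrA ler_wpM2l ?exprn_ge0//; apply: le_trans (xu _) _.
  by rewrite ler_wpM2l// exprS ler_piMl// ?exprn_ge0// ltW.
exists x; first by exists m.
rewrite -(subrK y v) -addrA [e]splitr.
apply: le_lt_trans (ler_normD _ _) _; rewrite ltrD// distrC.
have := xu 1%N; rewrite big_nat1 /u muln0/= expr1 => /le_lt_trans; apply.
apply: le_lt_trans (NP m Nm); rewrite -rE.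
by rewrite ler_pM// ?ler_wpM2l ?lef_pV2 ?lerD2l ?lerN2//.
Qed.

End HypercyclicityCriterion.

(** * Chaos and nonhypercyclicity of the weighted shift *)

Section AhatDynamics.
Variables (R : realType) (k : scalar_kind).
Local Notation F := (scalars R k).
Local Notation X := (X R k).
Implicit Types (w : F) (x y : X).

Lemma quotX_Ahat w x n : quot (Ahat w x) n = w * quot x n.+1.
Proof. exact: quot_Ahat. Qed.

Lemma Ahat_linear w : linear (Ahat w : X -> X).
Proof.
move=> a x y; apply: quotX_inj => n.
by rewrite quotXD quotXZ !quotX_Ahat quotXD quotXZ mulrDr mulrCA.
Qed.

Lemma quotX_iter_Ahat w n x j : quot (iter n (Ahat w) x) j = w ^+ n * quot x (j + n).
Proof.
elim: n j => [|n ih] j; first by rewrite mul1r addn0.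
by rewrite iterS quotX_Ahat ih mulrA -exprS addnS addSn.
Qed.

Lemma iter_AhatE w n x j :
  iter n (Ahat w) x j = w ^+ n * (j.+1%:R / (j.+1 + n)%:R * x (j + n)%N).
Proof.
have := quotX_iter_Ahat w n x j; rewrite /quot => /(canRL (mulfVK _)) ->; last first.
  by rewrite pnatr_eq0.
by rewrite addSn -[LHS]mulrA; congr (_ * _); rewrite mulrC mulrA mulrAC.
Qed.

(** The shift drops the first term of the variation, and [w] scales the others. *)
Lemma Ahat_norm_le w x : `|Ahat w x| <= `|w| * `|x|.
Proof.
apply: norm_le_sum_variation => n.
apply: (@le_trans _ _ (`|w| * \sum_(0 <= j < n.+1) variation x j)).
  rewrite big_nat_recl//= mulrDr mulr_sumr.
  rewrite ler_wpDl// ?mulr_ge0 ?variation_ge0//; apply: ler_sum => j _.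
  by rewrite /variation !quotX_Ahat -mulrBr normrM.
by rewrite ler_wpM2l// sum_variation_le_norm.
Qed.

(** The right shift repeats the first quotient, through [0.-1 = 0], instead of inserting 0. No
    variation is added at the front, whence the factor [|w|^-1]. *)
Lemma Ahat_right_inverse w : w != 0 -> exists S : X -> X,
  cancel S (Ahat w) /\ forall x, `|S x| <= `|w|^-1 * `|x|.
Proof.
move=> w0.
have /choice[S SP] : forall x, exists y : X,
    `|y| <= `|w|^-1 * `|x| /\ forall n, quot y n = w^-1 * quot x n.-1.
  move=> x; apply: quotX_surj => [n|].
    apply: le_trans (_ : `|w|^-1 * \sum_(0 <= j < n) variation x j <= _);
      last by rewrite ler_wpM2l ?invr_ge0// sum_variation_le_norm.
    case: n => [|n]; first by rewrite !big_geq// mulr0.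
    rewrite big_nat_recl//= subrr normr0 add0r mulr_sumr [leRHS]big_nat_recr//=.
    rewrite ler_wpDr ?mulr_ge0 ?invr_ge0 ?variation_ge0//.
    by apply: ler_sum => j _; rewrite -mulrBr normrM normfV.
  rewrite -[X in _ --> X](mulr0 w^-1); apply: cvgMl_tmp.
  have [_] := X_inX x.
  by rewrite -(cvg_shiftS (fun n => quot x n.-1)).
exists S; split=> x; last by have [] := SP x.
have [_ Sx] := SP x.
by apply: quotX_inj => n; rewrite quotX_Ahat Sx mulrA mulfV// mul1r.
Qed.

Lemma sum_delta_le (K : numDomainType) (i n : nat) :
  \sum_(0 <= j < n) (j == i)%:R <= 1 :> K.
Proof.
suff -> : \sum_(0 <= j < n) (j == i)%:R = (i < n)%:R :> K by rewrite lern1 leq_b1.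
elim: n => [|n ih]; first by rewrite big_geq.
by rewrite big_nat_recr//= ih -natrD ltnS; case: ltngtP.
Qed.

(* The basis is [e i = (i + 1) delta_(i + 1)] in the paper's coordinates. *)
Lemma X_basis : exists e : nat -> X, forall i,
  `|e i| <= 2 /\ forall n, quot (e i) n = (n == i)%:R.
Proof.
suff /choice : forall i, exists y : X,
    `|y| <= 2 /\ forall n, quot y n = (n == i)%:R.
  by move=> [e eP]; exists e.
move=> i; apply: quotX_surj => [n|].
  apply: (@le_trans _ _ (\sum_(0 <= j < n) ((j.+1 == i)%:R + (j == i)%:R))).
    by apply: ler_sum => j _; apply: le_trans (ler_normB _ _) _; rewrite !normr_nat.
  rewrite big_split/= (_ : 2 = 1 + 1)//; apply: lerD; last exact: sum_delta_le.
  case: i => [|i]; first by rewrite big1 ?ler01.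
  exact: sum_delta_le.
apply: cvg_near_cst; exists i.+1 => // n /= ni.
by rewrite gtn_eqF.
Qed.

Section Approximation.
Variable e : nat -> X.
Hypothesis e_le : forall i, `|e i| <= 2.
Hypothesis quot_e : forall i n, quot (e i) n = (n == i)%:R.

Lemma quot_comb (c : nat -> F) N n :
  quot (\sum_(0 <= i < N) c i *: e i) n = if (n < N)%N then c n else 0.
Proof.
elim: N => [|N ih]; first by rewrite big_geq// quotX0.
rewrite big_nat_recr// quotXD ih quotXZ quot_e ltnS.
case: ltngtP => [nN|nN|->]; rewrite ?mulr0 ?addr0// mulr1 add0r//.
Qed.

Lemma iter_Ahat_comb w (c : nat -> F) N :
  iter N (Ahat w) (\sum_(0 <= i < N) c i *: e i) = 0.
Proof.
apply: quotX_inj => n; rewrite quotX_iter_Ahat quot_comb quotX0.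
by rewrite ltnNge leq_addl mulr0.
Qed.

(** The coefficients [quot x i - quot x N] leave a remainder whose quotients equal [quot x N] before
    [N] and agree with those of [x] from [N] on. There is no jump at the cut, so the error is at
    most the tail of the variation of [x]. *)
Lemma comb_approx x (d : F) : 0 < d -> exists N (c : nat -> F),
  `|x - \sum_(0 <= i < N) c i *: e i| < d.
Proof.
move=> d0; have [cx _] := X_inX x.
have /cvgrPdist_lt/(_ _ d0)[N _ /(_ N (leqnn N))] :
    series (variation x) @ \oo --> `|x| by exact: cx.
rewrite /series/= ger0_norm ?subr_ge0 ?sum_variation_le_norm// => xN.
exists N, (fun i => quot x i - quot x N); apply: le_lt_trans xN.
set y := x - _.
have yE n : quot y n = if (n < N)%N then quot x N else quot x n.
  by rewrite quotXB quot_comb; case: ifP; rewrite ?subKr ?subr0.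
apply: norm_le_sum_variation => M; rewrite lerBrDl.
apply: le_trans (sum_variation_le_norm x (maxn N M)).
have Nm : (N <= maxn N M)%N by rewrite leq_maxl.
rewrite [leRHS](big_cat_nat _ (n := N))//= lerD2l.
apply: (@le_trans _ _ (\sum_(0 <= j < maxn N M) variation y j)).
  rewrite [leRHS](big_cat_nat _ (n := M)) ?leq_maxr//= lerDl sumr_ge0// => j _.
  exact: variation_ge0.
rewrite (big_cat_nat _ (n := N))//= big_nat big1 ?add0r => [|j /andP[_ jN]].
  rewrite big_nat [leRHS]big_nat; apply: ler_sum => j /andP[Nj _].
  by rewrite /variation !yE !ltnNge Nj (leq_trans Nj).
rewrite /variation !yE jN; case: ltnP => [_|Nj]; first by rewrite subrr normr0.
have <- : N = j.+1 by apply/eqP; rewrite eqn_leq jN Nj.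
by rewrite subrr normr0.
Qed.

End Approximation.

Lemma dense_nilpotent w : dense [set y : X | exists m, iter m (Ahat w) y = 0].
Proof.
have [e /all_and2[_ eE]] := X_basis.
apply/dense_normP => x d /(comb_approx eE x)[N [c xc]].
by exists (\sum_(0 <= i < N) c i *: e i) => //; exists N; exact: iter_Ahat_comb.
Qed.

Lemma countable_dense_nilpotent w : exists y : seq (rat * rat) -> X,
  (forall s, exists m, iter m (Ahat w) (y s) = 0) /\ dense (range y).
Proof.
have [e /all_and2[e2 eE]] := X_basis; have [f fP] := scalars_separable R k.
exists (fun s => \sum_(0 <= i < size s) f (nth 0 s i) *: e i); split=> [s|].
  by exists (size s); exact: iter_Ahat_comb.
apply/dense_normP => x d d0; have d2 : 0 < d / 2 by rewrite divr_gt0.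
have [N [c xc]] := comb_approx eE x d2.
(* The tolerance allows for at most [N] terms and for basis vectors of norm at most 2; [N.+1] avoids
   a division by 0. *)
have /choice[q qP] : forall i, exists q, `|c i - f q| < d / 2 / (N.+1%:R * 2).
  by move=> i; apply: fP; rewrite divr_gt0// mulr_gt0 ?ltr0n.
eexists; first by exists (mkseq q N).
rewrite /= size_mkseq.
rewrite -(subrK (\sum_(0 <= i < N) c i *: e i) x) -addrA [d]splitr.
apply: le_lt_trans (ler_normD _ _) _; rewrite ltr_leD// -sumrB.
apply: le_trans (ler_norm_sum _ _ _) _.
apply: (@le_trans _ _ (\sum_(0 <= i < N) d / 2 / (N.+1%:R * 2) * 2)).
  rewrite big_nat [leRHS]big_nat; apply: ler_sum => i /andP[_ iN].
  rewrite nth_mkseq// -scalerBl normrZ ler_pM//; exact: ltW.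
rewrite sumr_const_nat subn0 invfM mulrA divfK ?pnatr_eq0//.
rewrite -[leLHS]mulr_natr -mulrA ler_piMr ?ltW// ltr_pdivrMl ?ltr0n// mulr1.
by rewrite ltr_nat.
Qed.

(** The criterion is applied to the power itself, with [L] and [c] equal to the powers [n] of [|w|]
    and [|w|^-1]; [n = 1] gives the operator. *)
Lemma iter_Ahat_chaotic w n : 1 < `|w| -> (0 < n)%N -> chaotic (iter n (Ahat w)).
Proof.
move=> w1 n0; have w0 : w != 0 by rewrite -normr_gt0 (lt_trans _ w1).
have [S [SK Sw]] := Ahat_right_inverse w0.
have linB : linear (iter n (Ahat w) : X -> X).
  by apply: linear_iter; exact: Ahat_linear.
have wV0 : 0 <= `|w|^-1 by rewrite invr_ge0.
have B_le x : `|iter n (Ahat w) x| <= `|w| ^+ n * `|x|.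
  by apply: iter_norm_le => //; exact: Ahat_norm_le.
have S_le x : `|iter n S x| <= `|w|^-1 ^+ n * `|x| by exact: iter_norm_le.
have c01 : 0 <= `|w|^-1 ^+ n < 1.
  by rewrite exprn_ge0//= exprn_ilt1 -?lt0n// invf_lt1// normr_gt0.
have K : cancel (iter n S) (iter n (Ahat w)).
  by move=> x; rewrite iter_cancel_le// subnn.
have nil y : (exists m, iter m (Ahat w) y = 0) ->
    exists m, iter m (iter n (Ahat w)) y = 0.
  move=> [m ym]; exists m; rewrite -iterM.
  by apply: iter_linear0 ym _; [exact: Ahat_linear|rewrite leq_pmulr].
split.
  have [y [ynil dy]] := countable_dense_nilpotent w.
  apply: (hypercyclic_of_nilpotent_dense linB _ B_le c01 S_le K _ dy) => [|s|].
  - exact: exprn_ge0.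
  - exact: nil.
  - have [e /all_and2[_ eE]] := X_basis; exists (e 0%N); apply/eqP => e0.
    by have := eE 0%N 0%N; rewrite e0 quotX0 => /eqP; rewrite eq_sym oner_eq0.
apply: (dense_periodic_of_nilpotent_dense linB _ B_le c01 S_le K).
  exact: exprn_ge0.
apply/dense_normP => x d d0.
have [y /nil ynil xy] := (dense_normP _).1 (dense_nilpotent w) x d d0.
by exists y.
Qed.

Lemma Ahat_not_hypercyclic w : `|w| <= 1 -> ~ hypercyclic (Ahat w : X -> X).
Proof.
(* The orbit stays in the closed ball of radius [|x|] around 0, and [2 *: x] is at distance at least
   [|x|] from that ball. *)
move=> w1 [x [x0 /dense_normP/(_ (2 *: x) `|x|)]].
rewrite normr_gt0 => /(_ x0)[_ [n _ <-]].
have Ax : `|iter n (Ahat w) x| <= `|x|.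
  apply: le_trans (iter_norm_le _ _ _ (Ahat_norm_le w)) _ => //.
  by rewrite ler_piMl// exprn_ile1.
apply/negP; rewrite -real_leNgt ?realE ?normr_ge0//.
have := lerB_normD (2 *: x) (- iter n (Ahat w) x); rewrite normrN normrZ.
apply: le_trans; rewrite ger0_norm// mulrDl mul1r -addrA lerDl subr_ge0//.
Qed.

End AhatDynamics.

(** * The spectrum and its parts *)

Section AhatSpectrum.
Variables (R : realType) (k : scalar_kind).
Local Notation F := (scalars R k).
Local Notation X := (X R k).
Implicit Types (w lambda : F) (x y : X).

Lemma quotX_shifted w lambda x n :
  quot (shifted (Ahat w) lambda x) n = w * quot x n.+1 - lambda * quot x n.
Proof. by rewrite quotXB quotXZ quotX_Ahat. Qed.

Lemma shifted_linear w lambda : linear (shifted (Ahat w) lambda : X -> X).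
Proof.
move=> a x y; apply: quotX_inj => n; rewrite [RHS]quotXD quotXZ !quotX_shifted.
rewrite !quotXD !quotXZ !mulrDr mulrN opprD addrACA.
by rewrite [w * _]mulrCA [lambda * _]mulrCA.
Qed.

Lemma Ahat_point_spectrum w lambda : `|lambda| < `|w| ->
  ~ injective (shifted (Ahat w) lambda : X -> X).
Proof.
move=> lw; have w0 : w != 0 by rewrite -normr_gt0; apply: le_lt_trans lw.
pose r := lambda / w.
have r01 : 0 <= `|r| < 1.
  by rewrite normr_ge0/= normrM normfV ltr_pdivrMr ?normr_gt0// mul1r.
have [n||x [_ xE]] := @quotX_surj R k (fun n => r ^+ n)
    (2 * (`|r| ^+ 0 / (1 - `|r|))).
- apply: le_trans (ler_wpM2l _ (geometric_block_le 0 n r01)) => //.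
  rewrite mulr_sumr; apply: ler_sum => j _; apply: le_trans (ler_normB _ _) _.
  rewrite !normrX mulrDl mul1r lerD// exprS ler_piMl ?exprn_ge0// ltW//.
  by case/andP: r01.
- apply/cvgrPdist_lt => e e0.
  have [N NP] := scalars_expr_small ler01 r01 e0.
  by exists N => // n /NP; rewrite mul1r sub0r normrN normrX.
move=> /(_ x 0) x0; have := xE 0%N; rewrite x0 ?quotX0 ?expr0.
  by move=> /eqP; rewrite eq_sym oner_eq0.
apply: quotX_inj => n; rewrite !quotX_shifted !xE !quotX0 !mulr0 subrr.
by rewrite exprS /r mulrA [w * _]mulrC divfK// subrr.
Qed.

(** In the kernel, [w * quot z n.+1 = lambda * quot z n] makes the moduli of the quotients
    nondecreasing; since they tend to 0, they vanish. *)
Lemma shifted_inj w lambda : `|w| <= `|lambda| -> lambda != 0 ->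
  injective (shifted (Ahat w) lambda : X -> X).
Proof.
move=> wl l0 x y xy; apply/eqP; rewrite -subr_eq0; apply/eqP; set z := x - y.
have zE n : w * quot z n.+1 = lambda * quot z n.
  apply/eqP; rewrite -subr_eq0 -quotX_shifted.
  have [f fE] := linear_mapE (shifted_linear w lambda).
  by rewrite fE linearB -fE xy subrr quotX0.
have zS n : `|quot z n| <= `|quot z n.+1|.
  rewrite -(ler_pM2l (_ : 0 < `|lambda|)) ?normr_gt0// -normrM -zE normrM.
  by rewrite ler_wpM2r.
apply: quotX_inj => n; rewrite quotX0; apply/eqP; rewrite -normr_le0 -(normr0 F).
have [_ z0] := X_inX z.
apply: (@num_ler_lim F (fun=> `|quot z n|) (fun m => `|quot z m|)).
- exact: cvg_cst.
- exact: cvg_norm.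
- by exists n => // m /=; apply: homo_leq (lexx) le_trans zS _ _.
Qed.

(** A telescoping sum with explicit remainder: the remainder tends to 0 outside the disc, and
    vanishes exactly when [Ahat w] kills [y] within [n] steps. *)
Lemma shifted_neumann w lambda y n : lambda != 0 ->
  shifted (Ahat w) lambda
    (\sum_(0 <= j < n) - lambda^-1 ^+ j.+1 *: iter j (Ahat w) y) =
  y - lambda^-1 ^+ n *: iter n (Ahat w) y.
Proof.
move=> l0; have [f fE] := linear_mapE (shifted_linear w lambda).
elim: n => [|n ih]; first by rewrite big_geq// expr0 scale1r subrr fE linear0.
rewrite big_nat_recr// fE linearD -fE ih /shifted.
have AZ a v : Ahat w (a *: v) = a *: (Ahat w v : X).
  by have [g ->] := linear_mapE (Ahat_linear w); rewrite linearZ.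
rewrite AZ scalerA mulrN exprS mulrA mulfV// mul1r !scaleNr opprK -exprS.
by rewrite [- _ + _]addrC addrA subrK.
Qed.

Lemma shifted_surj w lambda y : `|w| < `|lambda| ->
  exists x, shifted (Ahat w) lambda x = y.
Proof.
move=> wl; have l0 : 0 < `|lambda| by apply: le_lt_trans wl.
have l0' : lambda != 0 by rewrite -normr_gt0.
pose r := `|w| / `|lambda|.
have r0 : 0 <= r by rewrite divr_ge0.
have r01 : 0 <= r < 1 by rewrite r0 ltr_pdivrMr// mul1r.
have Ar n : `|lambda^-1 ^+ n *: iter n (Ahat w) y| <= `|y| * r ^+ n.
  rewrite normrZ normrX normfV.
  apply: le_trans (ler_wpM2l _ (iter_norm_le _ _ _ (Ahat_norm_le w))) _ => //.
    by rewrite exprn_ge0// invr_ge0.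
  by rewrite mulrA -exprMn [_^-1 * _]mulrC [leRHS]mulrC.
have [|x xu] := @X_geometric_series R k
    (fun j => - lambda^-1 ^+ j.+1 *: iter j (Ahat w) y) (`|lambda|^-1 * `|y|) r r01.
  move=> j; rewrite exprS -mulrN -scalerA normrZ normfV scaleNr normrN -mulrA.
  by rewrite ler_wpM2l// invr_ge0.
exists x; apply/eqP; rewrite -subr_eq0 -normr_le0.
pose D := `|lambda|^-1 * `|y| / (1 - r).
have D0 : 0 <= D.
  rewrite divr_ge0 ?mulr_ge0 ?invr_ge0// subr_ge0 ltW//.
  by case/andP: r01.
apply: (@le0_geometric _ _ _ ((`|w| + `|lambda|) * D + `|y|) r) => // [|n].
  by rewrite addr_ge0// mulr_ge0// addr_ge0.
set s := \sum_(0 <= j < n) - lambda^-1 ^+ j.+1 *: iter j (Ahat w) y.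
have -> : shifted (Ahat w) lambda x - y =
    shifted (Ahat w) lambda (x - s) - lambda^-1 ^+ n *: iter n (Ahat w) y.
  have [f fE] := linear_mapE (shifted_linear w lambda).
  rewrite [in RHS]fE linearB -fE shifted_neumann// opprB -[RHS]addrA; congr (_ + _).
  by rewrite addrAC subrr sub0r.
apply: le_trans (ler_normB _ _) _; rewrite mulrDl lerD//.
rewrite /shifted; apply: le_trans (ler_normB _ _) _; rewrite -mulrA mulrDl lerD//.
  by apply: le_trans (Ahat_norm_le _ _) _; rewrite ler_wpM2l// xu.
by rewrite normrZ ler_wpM2l// xu.
Qed.

Lemma shifted_dense_range w lambda : lambda != 0 ->
  dense (range (shifted (Ahat w) lambda : X -> X)).
Proof.
move=> l0; apply/dense_normP => x e e0.
have [y [m ym] xy] := (dense_normP _).1 (dense_nilpotent w) x e e0.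
exists y => //.
exists (\sum_(0 <= j < m) - lambda^-1 ^+ j.+1 *: iter j (Ahat w) y) => //.
by rewrite shifted_neumann// ym scaler0 subr0.
Qed.

(* With mu = lambda / w and D, d the successive differences of the quotients
   of x, y, the equation reads D_(n+1) - mu D_n = d_n / w.  Taking
   d_n = w mu^(n+1) (1/(n+1) - 1/(n+2)) forces |D_n| = |c - 1/(n+1)| for some
   constant c, which is never summable. *)
Lemma shifted_not_surj w lambda : w != 0 -> `|lambda| = `|w| ->
  exists y, forall x, shifted (Ahat w) lambda x <> y.
Proof.
move=> w0 lw; pose mu := lambda / w.
have mu1 n : `|mu ^+ n| = 1.
  by rewrite normrX normrM normfV lw divff ?expr1n// normr_eq0.
have mu0 n : mu ^+ n != 0 by rewrite -normr_eq0 mu1 oner_eq0.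
(* The sums of [a] telescope and stay below 1, which makes [d] absolutely summable. *)
pose a n : F := harmonic n - harmonic n.+1.
pose d n := w * (mu ^+ n.+1 * a n).
have a0 n : 0 <= a n by rewrite subr_ge0 lef_pV2 ?posrE ?ltr0n// ler_nat.
have dw n : \sum_(0 <= j < n) `|d j| <= `|w|.
  rewrite (eq_bigr (fun j => `|w| * a j)) => [|j _]; last first.
    by rewrite /d normrM [X in _ * X]normrM mu1 mul1r (ger0_norm (a0 j)).
  rewrite -mulr_sumr ler_piMr// /a.
  rewrite (eq_bigr (fun j => - (harmonic j.+1 - harmonic j))); last first.
    by move=> j _; rewrite opprB.
  rewrite sumrN telescope_sumr// opprB /harmonic/= invr1 gerBl invr_ge0//.
have /cvg_ex[l dl] := scalars_series_cvg dw.
(* Subtracting the limit [l] makes the quotients tend to 0 and leaves their differences equal to [d]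
   shifted by nothing: step [n] is [d n]. *)
have [|| y [_ yE]] := @quotX_surj R k (fun n => series d n - l) `|w|.
- move=> n; apply: le_trans (dw n); apply: ler_sum => j _.
  by rewrite /series/= big_nat_recr//= opprB addrA subrK addrAC subrr add0r.
- by rewrite -(subrr l); apply: cvgB => //; exact: cvg_cst.
exists y => x xy.
pose D n := quot x n.+1 - quot x n.
have DS n : D n.+1 = mu * D n + mu ^+ n.+1 * a n.
  have dE : w * (mu ^+ n.+1 * a n) = quot y n.+1 - quot y n.
    by rewrite !yE /series/= big_nat_recr//= opprB addrA subrK addrAC subrr add0r.
  apply: (mulfI w0); rewrite [RHS]mulrDr dE.
  have wmu : w * mu = lambda by rewrite /mu mulrC divfK.
  rewrite -xy !quotX_shifted /D [w * (mu * _)]mulrA wmu !mulrBr.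
  by rewrite opprB [RHS]addrACA addKr [X in _ = X + _]addrC subrK.
pose c := D 0%N + harmonic 0.
have Dc n : D n = mu ^+ n * (c - harmonic n).
  elim: n => [|n ih]; first by rewrite mul1r /c addrK.
  rewrite DS ih mulrA -exprS -mulrDr /a; congr (_ * _).
  by rewrite addrA subrK.
have vc n : variation x n = `|c - harmonic n|.
  by rewrite -[LHS]/`|D n| Dc normrM mu1 mul1r.
have [cx _] := X_inX x.
(* The variation of [x] is summable, so [|c - harmonic n|] tends to 0, which forces [c = 0]; the
   variation is then the divergent harmonic series. *)
have c0 : c = 0.
  apply/eqP; apply: contraT => c0; have e0 : 0 < `|c| / 2.
    by rewrite divr_gt0// normr_gt0.
  have /cvgrPdist_lt/(_ _ e0)[N _ NP] := cvg_series_cvg_0 cx.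
  have [M MP] : exists M : nat, (`|c| / 2)^-1 < M%:R.
    by apply: scalars_archi; rewrite invr_ge0 ltW.
  pose n := maxn N M.
  have := NP n (leq_maxl _ _); rewrite /= sub0r normrN vc normr_id => cn.
  have hn : `|harmonic n| < `|c| / 2 :> F.
    rewrite ger0_norm ?invr_ge0// /harmonic/= invf_plt ?posrE ?ltr0n//.
    by apply: lt_le_trans MP _; rewrite ler_nat leqW// leq_maxr.
  have := ler_normD (c - harmonic n) (harmonic n); rewrite subrK [leLHS]splitr.
  by move=> /(le_lt_trans)/(_ (ltrD cn hn)); rewrite ltxx.
apply: (@dvg_harmonic F); rewrite (_ : harmonic = variation x)//.
by apply/funext => n; rewrite vc c0 sub0r normrN ger0_norm// invr_ge0.
Qed.

(** For [w = 0] the operator is 0 and has the eigenvalue 0, so the open disc and the circle do not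
    describe the two parts; they are claimed for [w != 0] only. *)
Lemma Ahat_spectrum w :
  spectrum (Ahat w : X -> X) = [set lambda | `|lambda| <= `|w|] /\
  (w != 0 ->
    point_spectrum (Ahat w : X -> X) = [set lambda | `|lambda| < `|w|] /\
    continuous_spectrum (Ahat w : X -> X) = [set lambda | `|lambda| = `|w|]).
Proof.
have neq0 lambda : `|w| < `|lambda| -> lambda != 0.
  by rewrite -(normr_gt0 lambda); apply: le_lt_trans.
have gt_onto lambda : `|w| < `|lambda| ->
    range (shifted (Ahat w) lambda : X -> X) = setT.
  by move=> wl; apply/seteqP; split=> // y _;
    have [x <-] := shifted_surj y wl; exists x.
have eq_cont lambda : w != 0 -> `|lambda| = `|w| ->
    continuous_spectrum (Ahat w : X -> X) lambda.
  move=> w0 lw; have l0 : lambda != 0 by rewrite -normr_eq0 lw normr_eq0.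
  split; first by apply: shifted_inj => //; rewrite lw.
  - have [y yN] := shifted_not_surj w0 lw.
    by move/seteqP => [_ /(_ y I)[x _ /yN]].
  - exact: shifted_dense_range.
split.
  apply/seteqP; split=> lambda /=; last first.
    rewrite le_eqVlt => /predU1P[lw|lw]; last first.
      by left; left; exact: Ahat_point_spectrum.
    have [w0|w0] := eqVneq w 0; last by left; right; exact: eq_cont.
    left; left => inj.
    have l0 : lambda = 0 by apply/eqP; rewrite -normr_eq0 lw w0 normr0.
    have [e /all_and2[_ eE]] := X_basis R k.
    have e0 : e 0%N = 0.
      apply: inj; apply: quotX_inj => n.
      by rewrite !quotX_shifted w0 l0 !mul0r.
    by have := eE 0%N 0%N; rewrite e0 quotX0 => /eqP; rewrite eq_sym oner_eq0.
  (* Outside the closed disc the shifted operator is injective and onto, which excludes all three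
     parts of the spectrum. *)
  rewrite real_leNgt ?normr_real// => sl; apply/negP => wl.
  case: sl => [[|[_ + _]]|[_]].
  - by apply; apply: shifted_inj; [exact: ltW|exact: neq0].
  - by apply; exact: gt_onto.
  - by apply; rewrite gt_onto// => U [x Ux] _; exists x.
move=> w0; split; apply/seteqP; split=> lambda /=.
- move=> ninj; rewrite real_ltNge ?normr_real//; apply/negP => wl; apply: ninj.
  apply: shifted_inj => //; rewrite -normr_gt0; apply: lt_le_trans wl.
  by rewrite normr_gt0.
- exact: Ahat_point_spectrum.
- move=> [inj nonto _].
  have [lw|wl|//] := real_ltgtP (normr_real lambda) (normr_real w).
  + by have := Ahat_point_spectrum lw.
  + by have := gt_onto _ wl.
- exact: eq_cont.
Qed.

End AhatSpectrum.

Theorem theorem6p1 (R : realType) (k : scalar_kind) (w : scalars R k) :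
  (linear (Ahat w) /\ bounded_operator (Ahat w)) /\
  (forall n : nat, (0 < n)%N -> forall (x : X R k) (j : nat),
     iter n (Ahat w) x j = w ^+ n * (j.+1%:R / (j.+1 + n)%:R * x (j + n)%N)) /\
  (1 < `|w| ->
     chaotic (Ahat w) /\
     forall n : nat, (0 < n)%N -> chaotic (iter n (Ahat w))) /\
  (`|w| <= 1 -> ~ hypercyclic (Ahat w)) /\
  (k = ComplexScalars ->
     spectrum (Ahat w) = [set lambda | `|lambda| <= `|w|] /\
     (w != 0 ->
        point_spectrum (Ahat w) = [set lambda | `|lambda| < `|w|] /\
        continuous_spectrum (Ahat w) = [set lambda | `|lambda| = `|w|])).
Proof.
split.
  by split; [exact: Ahat_linear|exists `|w| => x; exact: Ahat_norm_le].
split; first by move=> n _ x j; exact: iter_AhatE.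
split=> [w1|].
  by split=> [|n n0]; [exact: (@iter_Ahat_chaotic _ _ w 1)|exact: iter_Ahat_chaotic].
split; first exact: Ahat_not_hypercyclic.
by move=> _; exact: Ahat_spectrum.
Qed.
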